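(* Let $K$ be a field, let $d,n\ge 2$ be integers with $n(d-1)>d$, and let $\mathbf a=(a_1,\ldots,a_n)$ with $a_i=d-1$ for $i=1,\ldots,n$. Then the ideal of Veronese type $I_{\mathbf a,d}\subset K[x_1,\ldots,x_n]$ is Freiman if and only if $n=2$, or $n=3$ and $d=2$.
   Context: For positive integers $n,d$ and a sequence $\mathbf a$ of integers $1\le a_1\le\cdots\le a_n\le d$ with $\sum_{i=1}^n a_i>d$, the ideal of Veronese type $I_{\mathbf a,d}\subset S=K[x_1,\ldots,x_n]$ is the monomial ideal whose minimal set of monomial generators is $\{x_1^{b_1}\cdots x_n^{b_n}\mid \sum_{i=1}^n b_i=d,\ 0\le b_i\le a_i \text{ for } i=1,\ldots,n\}$. For a graded ideal $I\subset S$, $\mu(I)$ denotes the minimal number of generators of $I$; the fiber cone is $F(I)=\bigoplus_{k\ge 0} I^k/\mathfrak m I^k$ with $\mathfrak m=(x_1,\ldots,x_n)$, and the analytic spread $\ell(I)$ is the Krull dimension of $F(I)$. A monomial ideal $I$ that is equigenerated (minimally generated by monomials of one degree) is called Freiman if $\mu(I^2)=\ell(I)\mu(I)-\binom{\ell(I)}{2}$. *)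

(* Defs.v *)
From HB Require Import structures.
From mathcomp Require Import all_boot all_order all_algebra.
From mathcomp Require Import generic_quotient ring_quotient.
From mathcomp Require Import boolp.
From mathcomp Require Import mpoly.

Set Implicit Arguments.
Unset Strict Implicit.
Unset Printing Implicit Defensive.

Import GRing.Theory.
Local Open Scope ring_scope.

Section Ideals.
Variable R : comNzRingType.
Implicit Types (G I J : {pred R}).

Definition ideal_gen G : {pred R} := fun x =>
  `[< exists2 s : seq (R * R),
        {in s, forall u, u.2 \in G} & x = \sum_(u <- s) u.1 * u.2 >].

Definition ideal_prod I J : {pred R} :=
  ideal_gen (fun x => `[< exists a b, [/\ a \in I, b \in J & x = a * b] >]).

(* I^0 is the whole ring, so that I^1 is the ideal generated by I. *)
Definition ideal_exp I (k : nat) : {pred R} := iter k (ideal_prod I) predT.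

Definition has_min_gens I (m : nat) : Prop :=
  (exists2 s : seq R, size s = m & I =i ideal_gen (mem s)) /\
  (forall s : seq R, I =i ideal_gen (mem s) -> (m <= size s)%N).

Lemma ideal_genP G x :
  reflect (exists2 s : seq (R * R),
             {in s, forall u, u.2 \in G} & x = \sum_(u <- s) u.1 * u.2)
          (x \in ideal_gen G).
Proof. exact: asboolP. Qed.

Lemma mem_ideal_gen G x : x \in G -> x \in ideal_gen G.
Proof.
move=> xG; apply/ideal_genP; exists [:: (1, x)].
  by move=> u; rewrite inE => /eqP ->.
by rewrite big_seq1 mul1r.
Qed.

Lemma ideal_gen0 G : 0 \in ideal_gen G.
Proof. by apply/ideal_genP; exists [::] => //; rewrite big_nil. Qed.

Lemma ideal_genD G x y :
  x \in ideal_gen G -> y \in ideal_gen G -> x + y \in ideal_gen G.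
Proof.
move=> /ideal_genP[s sG ->] /ideal_genP[t tG ->].
apply/ideal_genP; exists (s ++ t); last by rewrite big_cat.
by move=> u; rewrite mem_cat => /orP[/sG|/tG].
Qed.

Lemma ideal_genM G a x : x \in ideal_gen G -> a * x \in ideal_gen G.
Proof.
move=> /ideal_genP[s sG ->].
apply/ideal_genP; exists [seq (a * u.1, u.2) | u <- s].
  by move=> u /mapP[v vs ->] /=; apply: sG.
by rewrite big_map mulr_sumr; apply: eq_bigr => u _; rewrite mulrA.
Qed.

Lemma ideal_genN G x : x \in ideal_gen G -> - x \in ideal_gen G.
Proof. by rewrite -mulN1r => xG; apply: ideal_genM. Qed.

Lemma ideal_gen_sum G (T : Type) (r : seq T) (P : pred T) (F : T -> R) :
  (forall i, P i -> F i \in ideal_gen G) ->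
  \sum_(i <- r | P i) F i \in ideal_gen G.
Proof.
move=> h; apply: (big_ind (fun x => x \in ideal_gen G)) => //.
  exact: ideal_gen0.
by move=> x y; apply: ideal_genD.
Qed.

Lemma ideal_gen_mulr_sub G H y :
  (forall g, g \in G -> g * y \in ideal_gen H) ->
  forall x, x \in ideal_gen G -> x * y \in ideal_gen H.
Proof.
move=> h x /ideal_genP[s sG ->]; rewrite mulr_suml big_seq.
apply: ideal_gen_sum => u /sG /h uH.
by rewrite -mulrA; apply: ideal_genM.
Qed.

Lemma mem_ideal_prod I J a b : a \in I -> b \in J -> a * b \in ideal_prod I J.
Proof. by move=> aI bJ; apply: mem_ideal_gen; apply/asboolP; exists a, b. Qed.

Lemma ideal_prod_sub I J y H :
  (forall a b, a \in I -> b \in J -> a * b * y \in ideal_gen H) ->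
  forall x, x \in ideal_prod I J -> x * y \in ideal_gen H.
Proof.
move=> h; apply: ideal_gen_mulr_sub => _ /asboolP[a [b [aI bJ ->]]].
exact: h.
Qed.

Lemma ideal_exp_closed I k :
  [/\ 0 \in ideal_exp I k,
      forall x y, x \in ideal_exp I k -> y \in ideal_exp I k ->
        x + y \in ideal_exp I k,
      forall a x, x \in ideal_exp I k -> a * x \in ideal_exp I k
    & forall x, x \in ideal_exp I k -> - x \in ideal_exp I k].
Proof.
case: k => [|k]; first by split.
split; [exact: ideal_gen0 | exact: ideal_genD | exact: ideal_genM |].
exact: ideal_genN.
Qed.

Lemma ideal_expD I i j x y :
  x \in ideal_exp I i -> y \in ideal_exp I j -> x * y \in ideal_exp I (i + j).
Proof.
elim: i x y => [|i IHi] x y xI yI.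
  by have [_ _ + _] := ideal_exp_closed I j; apply.
move: x xI; apply: ideal_prod_sub => a b aI bI.
by rewrite -mulrA; apply: mem_ideal_prod => //; apply: IHi.
Qed.

Lemma ideal_prod_expD M I i j x y :
  x \in ideal_exp I i -> y \in ideal_prod M (ideal_exp I j) ->
  x * y \in ideal_prod M (ideal_exp I (i + j)).
Proof.
move=> xI; rewrite [x * y]mulrC; move: y; apply: ideal_prod_sub => a b aM bI.
rewrite -mulrA; apply: mem_ideal_prod => //.
by rewrite mulrC; apply: ideal_expD.
Qed.

End Ideals.

Section Krull.
Variable R : comNzRingType.

Definition prime_ideal (P : {pred R}) : Prop :=
  idealr_closed P /\ prime_idealr_closed P.

Definition prime_chain (l : nat) (P : nat -> {pred R}) : Prop :=
  (forall i, (i <= l)%N -> prime_ideal (P i)) /\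
  (forall i, (i < l)%N -> {subset P i <= P i.+1} /\ ~ (P i =i P i.+1)).

Definition has_krull_dim (l : nat) : Prop :=
  (exists P, prime_chain l P) /\
  (forall k P, prime_chain k P -> (k <= l)%N).

End Krull.

(* The Rees algebra \bigoplus_k I^k, as the subring \sum_k I^k t^k of S[t]. *)
Section Rees.
Variables (S : comNzRingType) (I : {pred S}).

Definition rees_pred : {pred {poly S}} :=
  fun p => `[< forall k, p`_k \in ideal_exp I k >].

Lemma rees_subring_closed : subring_closed rees_pred.
Proof.
split.
- apply/asboolP => k; rewrite coef1; case: k => [|k] //=.
  by have [] := ideal_exp_closed I k.+1.
- move=> p q /asboolP hp /asboolP hq; apply/asboolP => k; rewrite coefB.
  have [_ hD _ hN] := ideal_exp_closed I k.
  by apply: hD (hp k) _; apply: hN.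
- move=> p q /asboolP hp /asboolP hq; apply/asboolP => k; rewrite coefM.
  have [h0 hD _ _] := ideal_exp_closed I k.
  apply: (big_ind (fun x => x \in ideal_exp I k)) => //= i _.
  by have := ideal_expD (hp i) (hq (k - i)%N); rewrite subnKC // -ltnS.
Qed.

HB.instance Definition _ :=
  GRing.isSubringClosed.Build {poly S} rees_pred rees_subring_closed.

Record rees := Rees { rees_val :> {poly S}; _ : rees_val \in rees_pred }.

HB.instance Definition _ := [isSub for rees_val].
HB.instance Definition _ := [Choice of rees by <:].
HB.instance Definition _ := [SubChoice_isSubComNzRing of rees by <:].

End Rees.

Section FiberCone.
Variables (K : fieldType) (n : nat).
Local Notation S := {mpoly K[n]}.

Definition irrelevant_ideal : {pred S} :=
  ideal_gen [pred p | [exists i, p == 'X_i]].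

Lemma irrelevant_ideal_eval0 p :
  p \in irrelevant_ideal -> p.@[fun=> 0] = 0.
Proof.
move=> /ideal_genP[s sG ->]; rewrite raddf_sum big_seq big1 //= => u /sG.
by move=> /existsP[i /eqP ->]; rewrite mevalM mevalXU mulr0.
Qed.

Variable I : {pred S}.

(* The ideal \bigoplus_k m I^k of the Rees algebra. *)
Definition fiber_ideal : {pred rees I} := fun p =>
  `[< forall k,
        (rees_val p)`_k \in ideal_prod irrelevant_ideal (ideal_exp I k) >].

Lemma fiber_ideal_closed : idealr_closed fiber_ideal.
Proof.
split.
- apply/asboolP => k; rewrite [rees_val 0]raddf0 coef0; exact: ideal_gen0.
- apply/negP => /asboolP /(_ 0%N).
  rewrite [rees_val 1]rmorph1 coef1 /= => h1.
  have: 1 * 1 \in irrelevant_ideal.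
    move: h1; apply: ideal_prod_sub => a b aM _; rewrite mulr1 mulrC.
    exact: ideal_genM.
  move=> /irrelevant_ideal_eval0 /eqP; rewrite mulr1 meval1.
  by rewrite oner_eq0.
- move=> a p q /asboolP hp /asboolP hq; apply/asboolP => k.
  rewrite -[rees_val _]/(val (a * p + q)) rmorphD rmorphM coefD.
  apply: ideal_genD (hq k); rewrite coefM.
  apply: ideal_gen_sum => i _.
  have ai : (rees_val a)`_i \in ideal_exp I i by case: (a) => r /= /asboolP.
  by have := ideal_prod_expD ai (hp (k - i)%N); rewrite subnKC // -ltnS.
Qed.

HB.instance Definition _ :=
  isIdealr.Build (rees I) fiber_ideal fiber_ideal_closed.

(* The quotient of the Rees algebra is \bigoplus_k I^k / m I^k. *)
Definition fiber_cone : comNzRingType := {ideal_quot fiber_ideal}.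

Definition has_analytic_spread (l : nat) : Prop := has_krull_dim fiber_cone l.

End FiberCone.

Section Freiman.
Variables (K : fieldType) (n : nat).

Definition monomial_ideal (B : {pred 'X_{1..n}}) : {pred {mpoly K[n]}} :=
  ideal_gen (fun p => `[< exists2 m, m \in B & p = 'X_[m] >]).

(* Distinct monomials of the same degree do not divide each other, so [B] is
   automatically the minimal set of monomial generators. *)
Definition equigenerated_monomial (I : {pred {mpoly K[n]}}) : Prop :=
  exists (e : nat) (B : {pred 'X_{1..n}}),
    {in B, forall m, mdeg m = e} /\ I =i monomial_ideal B.

Definition veronese_type (a : 'I_n -> nat) (d : nat) : {pred {mpoly K[n]}} :=
  monomial_ideal [pred b | (mdeg b == d) && [forall i, (b i <= a i)%N]].

(* The equation is read in the integers, the subtraction on nat being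
   truncated. *)
Definition freiman (I : {pred {mpoly K[n]}}) : Prop :=
  equigenerated_monomial I /\
  exists mu1 mu2 l : nat,
    [/\ has_min_gens I mu1, has_min_gens (ideal_exp I 2) mu2,
        has_analytic_spread I l
      & mu2%:Z = l%:Z * mu1%:Z - 'C(l, 2)%:Z].

End Freiman.
Arguments veronese_type : clear implicits.

(* Main.v *)
Require Import Defs.
From HB Require Import structures.
From mathcomp Require Import all_boot all_order all_algebra.
From mathcomp Require Import generic_quotient ring_quotient boolp.
From mathcomp Require Import mpoly zify.

(** Let [B] be the set of exponents of the generators of [I], [mu1 = #|B|].  All
three invariants in the Freiman equation can be computed.

_Generators._  The degree [e] parts of any generating family of an ideal
generated by monomials of degree [e] span the space on these monomials, so the
minimal number of generators is the number of monomials
([min_gens_monomial_ideal]).  Halving exponents shows that [I ^ 2] is generated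
by the monomials of degree [2 d] with all exponents at most [2 (d - 1)]
([bounded_split]); let [mu2] be their number.

_Analytic spread._  Sending each component of the Rees algebra to its part of
lowest degree embeds the fiber cone in [S = K[x_1, ..., x_n]]
([fiber_map_exists]).  If [P_0] is properly contained in [P_1] and [f] lies in
[P_1] but not in [P_0], then the products of powers of [f] with elements
independent modulo [P_1] are independent modulo [P_0]; hence a chain of length
[l] gives, for every [k], [k ^ l] independent elements whose degrees are linear
in [k], and comparing with the number of monomials in [n] variables gives
[l <= n] ([prime_chain_le]).  Conversely, putting the variables equal to 1 one
after the other gives [n + 1] prime ideals of the fiber cone, as kernels; the
inclusions are strict as soon as each step identifies two monomials of the cone
([analytic_spread_echelon]).  So the analytic spread is [n].

_Counting._  Sort the generators of [I ^ 2] by the set of variables with exponent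
at least [d], which has at most two elements.  For a given variable there are
[mu1] generators for which it is in this set, and for a given pair of variables
there is one, so that [mu2 = n * mu1 - 'C(n, 2) + h], where [h] is the number of
monomials of degree [2 d] with all exponents at most [d - 1] ([size_square_exps]).
The ideal is therefore Freiman if and only if [h = 0], which means
[n * (d - 1) < 2 * d], that is, [n = 2], or [n = 3] and [d = 2]. *)

Set Implicit Arguments.
Unset Strict Implicit.
Unset Printing Implicit Defensive.

Import GRing.Theory.
Local Open Scope ring_scope.
Local Open Scope quotient_scope.

(** * Ideals generated by monomials *)

Lemma lem_mdeg n (a b : 'X_{1..n}) : (a <= b)%MM -> (mdeg a <= mdeg b)%N.
Proof. by move=> /mnm_lepP ab; rewrite !mdegE; apply: leq_sum. Qed.

Lemma ideal_gen_sub (R : comNzRingType) (G H : {pred R}) :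
  {subset G <= ideal_gen H} -> {subset ideal_gen G <= ideal_gen H}.
Proof.
move=> GH x xG; rewrite -[x]mulr1; apply: ideal_gen_mulr_sub xG => g gG.
by rewrite mulr1; apply: GH.
Qed.

Section MonomialIdeals.
Variables (K : fieldType) (n : nat).
Local Notation S := {mpoly K[n]}.
Implicit Types (B C : {pred 'X_{1..n}}) (I J : {pred S}) (p q : S).

Lemma mem_monomial_ideal B b m :
  b \in B -> (b <= m)%MM -> 'X_[m] \in monomial_ideal (K := K) B.
Proof.
move=> bB bm; rewrite -(submK bm) mpolyXD; apply: ideal_genM.
by apply: mem_ideal_gen; apply/asboolP; exists b.
Qed.

Lemma monomial_idealP B p :
  reflect (forall m, m \in msupp p -> exists2 b, b \in B & (b <= m)%MM)
          (p \in monomial_ideal B).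
Proof.
apply: (iffP idP) => [/ideal_genP[s sG ->] m|pB].
  move=> /msupp_sum_le /flattenP[_ /mapP[u + ->]].
  rewrite mem_filter /= => /sG /asboolP[b bB ->].
  move=> /msuppM_le /allpairsP[[m1 m2] /= [_]].
  rewrite msuppX inE => /eqP -> ->; exists b => //; exact: lem_addl.
rewrite (mpolyE p) big_seq; apply: ideal_gen_sum => m /pB[b bB bm].
rewrite -mul_mpolyC; apply: ideal_genM; exact: mem_monomial_ideal bB bm.
Qed.

Definition mnm_sumset B C : {pred 'X_{1..n}} :=
  fun m => `[< exists a b, [/\ a \in B, b \in C & m = (a + b)%MM] >].

Definition mnm_sums B (k : nat) : {pred 'X_{1..n}} :=
  iter k (mnm_sumset B) (pred1 0%MM).

Lemma ideal_prod_monomial I J B C :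
  I =i monomial_ideal B -> J =i monomial_ideal C ->
  ideal_prod I J =i monomial_ideal (mnm_sumset B C).
Proof.
move=> IB JC p; apply/idP/idP.
  apply: ideal_gen_sub => _ /asboolP[x [y [+ + ->]]].
  rewrite IB JC => xB yC.
  apply: ideal_gen_mulr_sub xB => _ /asboolP[b bB ->].
  rewrite mulrC; apply: ideal_gen_mulr_sub yC => _ /asboolP[c cC ->].
  rewrite -mpolyXD addmC; apply: mem_ideal_gen; apply/asboolP.
  by exists (b + c)%MM => //; apply/asboolP; exists b, c.
apply: ideal_gen_sub => _ /asboolP[_ /asboolP[b [c [bB cC ->]]] ->].
rewrite mpolyXD; apply: mem_ideal_prod; rewrite (IB, JC).
  exact: mem_monomial_ideal bB (lepm_refl _).
exact: mem_monomial_ideal cC (lepm_refl _).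
Qed.

Lemma ideal_exp_monomial I B k :
  I =i monomial_ideal B -> ideal_exp I k =i monomial_ideal (mnm_sums B k).
Proof.
move=> IB; elim: k => [|k IHk]; last exact: ideal_prod_monomial.
move=> p; rewrite [LHS]inE; symmetry; apply/monomial_idealP => m _.
exists 0%MM; first exact: eqxx.
by apply/mnm_lepP => i; rewrite mnm0E.
Qed.

Lemma mdeg_mnm_sums B e k m :
  {in B, forall m, mdeg m = e} -> m \in mnm_sums B k -> mdeg m = (e * k)%N.
Proof.
move=> Be; elim: k m => [|k IHk] m.
  by rewrite inE => /eqP ->; rewrite mdeg0 muln0.
by move=> /asboolP[b [c [/Be bB /IHk cB ->]]]; rewrite mdegD bB cB mulnS.
Qed.

Lemma eq_monomial_ideal B C :
  B =i C -> monomial_ideal (K := K) B =i monomial_ideal C.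
Proof.
move=> BC p; apply/monomial_idealP/monomial_idealP => pB m /pB [b bB bm];
  by exists b; rewrite // ?BC // -BC.
Qed.

Lemma mcoeff_pihomog e p m :
  (pihomog mdeg e p)@_m = if mdeg m == e then p@_m else 0.
Proof.
rewrite pihomogE [in RHS](mpolyE p) !raddf_sum /= big_mkcond /=.
case: ifPn => [/eqP <-|me]; last first.
  apply: big1 => m' _; case: ifP => // /eqP m'e.
  rewrite mcoeffZ mcoeffX; have [m'm|_] := eqVneq m' m; last by rewrite mulr0.
  by rewrite -m'm m'e eqxx in me.
apply: eq_bigr => m' _; case: ifPn => // m'm.
rewrite mcoeffZ mcoeffX; have [m'm'|_] := eqVneq m' m; last by rewrite mulr0.
by rewrite m'm' eqxx in m'm.
Qed.

(** A product of terms reaches the degree [a + b] only if the factors have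
    degrees [a] and [b], as these are the smallest ones allowed. *)
Lemma pihomogM_low a b p q :
  {in msupp p, forall m, (a <= mdeg m)%N} ->
  {in msupp q, forall m, (b <= mdeg m)%N} ->
  pihomog mdeg (a + b) (p * q) = pihomog mdeg a p * pihomog mdeg b q.
Proof.
move=> pa qb; rewrite [in LHS](mpolyE p) [in LHS](mpolyE q).
rewrite [pihomog mdeg a p]pihomogE [pihomog mdeg b q]pihomogE.
rewrite !mulr_suml raddf_sum [RHS]big_mkcond /= big_seq [RHS]big_seq.
apply: eq_bigr => m /pa am; rewrite !mulr_sumr raddf_sum /=.
case: ifPn => ma; last first.
  rewrite big_seq; apply: big1 => m' /qb bm'.
  rewrite -scalerAl -scalerAr -mpolyXD !linearZ /= pihomogX /= mdegD.
  case: eqP => [E|_]; last by rewrite !scaler0.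
  by case/eqP: ma; apply/eqP; rewrite eqn_leq am -(leq_add2r b) -E leq_add2l bm'.
rewrite [RHS]big_mkcond /=; apply: eq_bigr => m' _.
rewrite -scalerAl -scalerAr -mpolyXD !linearZ /= pihomogX /= mdegD (eqP ma).
rewrite eqn_add2l; case: ifP => _; rewrite ?scaler0 ?mulr0 //.
by rewrite mpolyXD !scalerA mulrC.
Qed.

(** An element of an ideal generated in degree [e] has no term of degree below
    [e], so multiplying it by [a] affects its degree [e] part only through the
    constant term of [a].  The degree [e] parts of a generating family therefore
    span the space with basis the monomial generators, whence the bound. *)
Lemma min_gens_monomial_ideal I (s : seq 'X_{1..n}) e :
  uniq s -> {in s, forall m, mdeg m = e} -> I =i monomial_ideal (mem s) ->
  has_min_gens I (size s).
Proof.
move=> s_uniq s_deg Is; split.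
  exists [seq 'X_[m] | m <- s]; first by rewrite size_map.
  move=> p; rewrite Is; apply/idP/idP; apply: ideal_gen_sub => q.
    by move=> /asboolP[m ms ->]; apply: mem_ideal_gen; apply: map_f.
  by move=> /mapP[m ms ->]; apply: mem_monomial_ideal ms (lepm_refl _).
move=> t It.
pose G := \matrix_(i < size t, j < size s) (t`_i)@_(nth 0%MM s j).
have tI q : q \in t -> q \in I by move=> qt; rewrite It; apply: mem_ideal_gen.
(* The lowest degree part of [a * q] is that of [q] times the constant term. *)
have coefI a q m : q \in I -> mdeg m = e -> (a * q)@_m = a@_0%MM * q@_m.
  rewrite Is => /monomial_idealP qI me.
  have qe : {in msupp q, forall m', (e <= mdeg m')%N}.
    by move=> m' /qI[b /s_deg <- /lem_mdeg].
  have := @mcoeff_pihomog (0 + e) (a * q) m; rewrite me eqxx => <-.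
  rewrite pihomogM_low //.
  have -> : pihomog mdeg 0 a = (a@_0%MM)%:MP.
    apply/mpolyP => m'; rewrite mcoeff_pihomog mcoeffC mdeg_eq0.
    by case: eqP => [->|_]; rewrite ?mulr1 ?mulr0.
  by rewrite mul_mpolyC mcoeffZ mcoeff_pihomog me eqxx.
suff GT : (1%:M <= G)%MS.
  by rewrite -(mxrank1 K (size s)) (leq_trans (mxrankS GT)) // rank_leq_row.
apply/row_subP => i; set m := nth 0%MM s i.
have ms : m \in s by apply: mem_nth.
have: 'X_[m] \in I by rewrite Is; apply: mem_monomial_ideal ms (lepm_refl _).
rewrite It => /ideal_genP[r rt Xr].
have -> : row i 1%:M = \sum_(u <- r) u.1@_0%MM *: 
             \row_(j < size s) u.2@_(nth 0%MM s j).
  apply/rowP => j; rewrite summxE !mxE.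
  transitivity (('X_[m] : S)@_(nth 0%MM s j)).
    by rewrite mcoeffX nth_uniq.
  rewrite Xr raddf_sum big_seq [RHS]big_seq; apply: eq_bigr => u /rt ut.
  by rewrite /= coefI ?tI // ?s_deg ?mem_nth // !mxE.
rewrite big_seq; apply: summx_sub => u /rt /(nthP 0)[k kt <-].
apply: scalemx_sub; rewrite (_ : \row_j _ = row (Ordinal kt) G) ?row_sub //.
by apply/rowP => j; rewrite !mxE.
Qed.

Lemma has_min_gens_inj I m1 m2 :
  has_min_gens I m1 -> has_min_gens I m2 -> m1 = m2.
Proof.
move=> [[s1 <- I1] h1] [[s2 <- I2] h2].
by apply/eqP; rewrite eqn_leq h1 // h2.
Qed.

End MonomialIdeals.

(** * Exponent vectors *)

Section Exponents.
Variable n : nat.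
Local Open Scope nat_scope.
Implicit Types (a : 'I_n -> nat) (b c m : 'X_{1..n}).

Lemma mdegB_le b c : (b <= c)%MM -> mdeg (c - b) = mdeg c - mdeg b.
Proof. by move=> bc; rewrite -[in RHS](submK bc) mdegD addnK. Qed.

Definition bounded a : {pred 'X_{1..n}} :=
  [pred b : 'X_{1..n} | [forall i, b i <= a i]].

Lemma boundedP a b : reflect (forall i, b i <= a i) (b \in bounded a).
Proof. exact: forallP. Qed.

Definition mnms_of_deg k : seq 'X_{1..n} :=
  [seq bmnm b | b : 'X_{1..n < k.+1} <- enum {: 'X_{1..n < k.+1}} & mdeg b == k].

Lemma mem_mnms_of_deg k m : (m \in mnms_of_deg k) = (mdeg m == k).
Proof.
apply/mapP/eqP => [[b]|mk]; first by rewrite mem_filter => /andP[/eqP + _ ->].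
have mk1 : mdeg m < k.+1 by rewrite mk.
by exists (BMultinom mk1); rewrite // mem_filter /= mk eqxx mem_enum.
Qed.

Lemma mnms_of_deg_uniq k : uniq (mnms_of_deg k).
Proof.
rewrite map_inj_uniq; first exact/filter_uniq/enum_uniq.
by move=> b c /eqP; rewrite -bmeqP => /eqP.
Qed.

Lemma exists_subset_card (T : finType) (A : {set T}) k :
  k <= #|A| -> exists2 H : {set T}, H \subset A & #|H| = k.
Proof.
move=> kA; exists [set x in take k (enum A)].
  by apply/subsetP => x; rewrite inE => /mem_take; rewrite mem_enum.
rewrite cardsE; have /card_uniqP -> := take_uniq k (enum_uniq A).
by rewrite size_takel // -cardE.
Qed.

(** Halve every exponent, and share the leftover units of the odd exponents
    evenly between the two factors. *)
Lemma bounded_split a d b :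
  mdeg b = d.*2 -> b \in bounded (fun i => (a i).*2) ->
  exists c c', [/\ mdeg c = d, mdeg c' = d, c \in bounded a, c' \in bounded a
                 & b = (c + c')%MM].
Proof.
move=> bd /boundedP ba; pose O := [set i | odd (b i)].
have [h hE] : exists h, h = \sum_i (b i)./2 by eexists.
have hO : #|O| + h.*2 = d.*2.
  rewrite hE -bd mdegE -sum1_card big_mkcond -mul2n big_distrr -big_split /=.
  apply: eq_bigr => i _; rewrite inE mul2n -[in RHS](odd_double_half (b i)).
  by case: odd.
have cO : #|O| = (d - h).*2 by lia.
have hd : d - h <= #|O| by rewrite cO; lia.
have hled : h <= d by lia.
have [H HO Hd] := exists_subset_card hd.
pose half (A : {set 'I_n}) := [multinom (b i)./2 + (i \in A) | i < n].
have half_deg A : mdeg (half A) = h + #|A|.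
  rewrite hE mdegE -sum1_card [X in _ + X]big_mkcond -big_split.
  by apply: eq_bigr => i _; rewrite mnmE; case: (i \in A).
have half_bounded (A : {set 'I_n}) : A \subset O -> half A \in bounded a.
  move=> /subsetP AO; apply/boundedP => i; rewrite mnmE.
  have := ba i; have := AO i; rewrite inE.
  by case: (i \in A) => [/(_ isT)|_]; lia.
have DO : O :\: H \subset O by apply: subsetDl.
exists (half H), (half (O :\: H)); split; rewrite ?half_bounded //.
- by rewrite half_deg Hd; lia.
- by rewrite half_deg cardsD (setIidPr HO) Hd cO; lia.
apply/mnmP => i; rewrite mnmDE !mnmE inE.
have := subsetP HO i; rewrite !inE.
by case: (i \in H) => [/(_ isT)|_] /=; lia.
Qed.

Lemma exists_bounded a k :
  k <= \sum_i a i -> exists2 m, mdeg m = k & m \in bounded a.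
Proof.
elim: k => [_|k IHk ka].
  by exists 0%MM; rewrite ?mdeg0 //; apply/boundedP => i; rewrite mnm0E.
have [m mk /boundedP ma] := IHk (ltnW ka).
have [i mi] : exists i, m i < a i.
  apply/existsP; apply: contraTT ka => /existsPn am.
  by rewrite -leqNgt -mk mdegE; apply: leq_sum => i _; rewrite leqNgt.
exists (m + U_(i))%MM; first by rewrite mdegD mdeg1 mk addn1.
apply/boundedP => j; rewrite mnmDE mnm1E; have := ma j.
by case: eqP => [<-|_]; lia.
Qed.

(** * Counting exponent vectors *)

Lemma size_eq_card (T : eqType) (J : finType) (A : {pred J}) (f : J -> T)
    (s : seq T) :
  uniq s -> injective f ->
  (forall x, reflect (exists2 j, j \in A & x = f j) (x \in s)) ->
  size s = #|A|.
Proof.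
move=> s_uniq f_inj sE; rewrite cardE -(size_map f); apply: perm_size.
apply: uniq_perm => // [|x]; first by rewrite map_inj_uniq ?enum_uniq.
by apply/sE/mapP => -[j jA ->]; exists j => //; move: jA; rewrite mem_enum.
Qed.

Lemma mnmMnUE (i j : 'I_n) d : (U_(i) *+ d)%MM j = (i == j) * d.
Proof. by rewrite mulmnE mnm1E. Qed.

Variable d : nat.
Hypothesis d_gt1 : 1 < d.

(** What the bound excludes in degree [d] are the pure powers. *)
Lemma count_bounded_deg :
  count (mem (bounded (fun=> d - 1))) (mnms_of_deg d) + n = size (mnms_of_deg d).
Proof.
rewrite -(count_predC (mem (bounded (fun=> d - 1)))); congr (_ + _).
rewrite -size_filter -[LHS]card_ord; symmetry.
apply: (@size_eq_card _ _ _ (fun i => (U_(i) *+ d)%MM)).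
- by rewrite filter_uniq ?mnms_of_deg_uniq.
- move=> i j /(congr1 (fun m : 'X_{1..n} => m i)).
  by rewrite !mnmMnUE eqxx; case: eqP => [->|_] //; lia.
move=> m; rewrite mem_filter mem_mnms_of_deg; apply: (iffP andP).
  move=> [/= mb /eqP md].
  have [i mi] : exists i, d <= m i.
    apply/existsP; apply: contraNT mb => /existsPn mb; apply/boundedP => i.
    by have := mb i; lia.
  have im : (U_(i) *+ d <= m)%MM.
    by apply/mnm_lepP => j; rewrite mnmMnUE; case: eqP => [<-|_]; lia.
  exists i => //; rewrite -[LHS](submK im).
  have /eqP : mdeg (m - U_(i) *+ d) = 0.
    by rewrite mdegB_le // md mdegMn mdeg1; lia.
  by rewrite mdeg_eq0 => /eqP ->; rewrite add0m.
move=> [i _ ->]; rewrite /= mdegMn mdeg1 mul1n eqxx; split=> //.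
by apply/boundedP => /(_ i); rewrite mnmMnUE eqxx; lia.
Qed.

(** What this condition excludes are the [n] products of the [(d - 1)]-st power
    of the [i]-th variable with one more variable: as many monomials as are
    excluded in [count_bounded_deg]. *)
Lemma count_deg_coord i :
  count (fun m => m i <= d - 2) (mnms_of_deg d) + n = size (mnms_of_deg d).
Proof.
rewrite -(count_predC (fun m : 'X_{1..n} => m i <= d - 2)); congr (_ + _).
rewrite -size_filter -[LHS]card_ord; symmetry.
apply: (@size_eq_card _ _ _ (fun j => (U_(i) *+ (d - 1) + U_(j))%MM)).
- by rewrite filter_uniq ?mnms_of_deg_uniq.
- by move=> j k /addmI /eqP; rewrite eq_mnm1 => /eqP.
move=> m; rewrite mem_filter mem_mnms_of_deg /=; apply: (iffP andP).
  move=> [mi /eqP md].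
  have im : (U_(i) *+ (d - 1) <= m)%MM.
    by apply/mnm_lepP => j; rewrite mnmMnUE; case: eqP => [<-|_]; lia.
  have /eqP/mdeg1P[j /eqP mj] : mdeg (m - U_(i) *+ (d - 1)) = 1.
    by rewrite mdegB_le // md mdegMn mdeg1; lia.
  by exists j; rewrite // -[LHS](submK im) mj addmC.
move=> [j _ ->]; rewrite mnmDE mnmMnUE mdegD mdegMn !mdeg1 eqxx.
by split; [|apply/eqP]; lia.
Qed.

(** These are the exponents of the products of two monomials of degree [d] with
    all exponents at most [d - 1], by [bounded_split]. *)
Definition square_exps : seq 'X_{1..n} :=
  [seq m <- mnms_of_deg d.*2 | m \in bounded (fun=> (d - 1).*2)].

Lemma square_exps_uniq : uniq square_exps.
Proof. exact: filter_uniq (mnms_of_deg_uniq _). Qed.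

Lemma mem_square_exps m :
  (m \in square_exps) = (m \in bounded (fun=> (d - 1).*2)) && (mdeg m == d.*2).
Proof. by rewrite mem_filter mem_mnms_of_deg. Qed.

(** Division by the [d]-th power of the [i]-th variable leaves the monomials of
    degree [d] in which its exponent is at most [d - 2]; by
    [count_deg_coord] and [count_bounded_deg] these are as many as the monomials
    with all exponents at most [d - 1]. *)
Lemma count_square_exps_coord i :
  count (fun m => d <= m i) square_exps =
  count (mem (bounded (fun=> d - 1))) (mnms_of_deg d).
Proof.
apply/eqP; rewrite -(eqn_add2r n) count_bounded_deg -(count_deg_coord i) eqn_add2r.
rewrite -!size_filter eq_sym -(size_map (fun m => (m + U_(i) *+ d)%MM)) eq_sym.
apply/eqP/perm_size; apply: uniq_perm.
- exact: filter_uniq square_exps_uniq.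
- rewrite map_inj_uniq; first exact/filter_uniq/mnms_of_deg_uniq.
  exact: addIm.
move=> m; rewrite mem_filter mem_square_exps.
apply/and3P/mapP => [[im /boundedP mb /eqP md]|[c]].
  have iU : (U_(i) *+ d <= m)%MM.
    by apply/mnm_lepP => j; rewrite mnmMnUE; case: eqP => [<-|_]; lia.
  exists (m - U_(i) *+ d)%MM; last by rewrite submK.
  rewrite mem_filter mem_mnms_of_deg mdegB_le // mnmBE mnmMnUE eqxx md mdegMn mdeg1.
  by apply/andP; split; [have := mb i | apply/eqP]; lia.
rewrite mem_filter mem_mnms_of_deg => /andP[ci /eqP cd] ->.
rewrite mnmDE mnmMnUE mdegD mdegMn mdeg1 cd eqxx; split; [lia| |apply/eqP; lia].
apply/boundedP => j; rewrite mnmDE mnmMnUE.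
have : c j <= d by rewrite -cd mdegE (bigD1 j) //= leq_addr.
by case: eqP => [<-|_]; lia.
Qed.

Definition large (m : 'X_{1..n}) : {set 'I_n} := [set i | d <= m i].

Lemma large_le m : mdeg m = d.*2 -> #|large m| <= 2.
Proof.
move=> md; rewrite -(leq_pmul2r (ltnW d_gt1)) mul2n -md mdegE.
rewrite -sum_nat_const big_mkcond; apply: leq_sum => i _.
by rewrite inE; case: ifP.
Qed.

(** Two exponents that are at least [d] exhaust the total [2 d]. *)
Lemma count_large2 : count (fun m => #|large m| == 2) square_exps = 'C(n, 2).
Proof.
rewrite -[in RHS](card_ord n) -card_draws -size_filter.
pose f (A : {set 'I_n}) := [multinom (i \in A) * d | i < n].
have f_large (A : {set 'I_n}) : large (f A) = A.
  by apply/setP => i; rewrite inE mnmE; case: (i \in A); lia.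
have f_deg (A : {set 'I_n}) : mdeg (f A) = #|A| * d.
  rewrite mdegE -sum_nat_const [RHS]big_mkcond; apply: eq_bigr => i _.
  by rewrite mnmE; case: (i \in A); lia.
apply: (@size_eq_card _ _ _ f).
- exact: filter_uniq square_exps_uniq.
- by move=> A A' fA; rewrite -(f_large A) fA f_large.
move=> m; rewrite mem_filter mem_square_exps.
apply: (iffP and3P) => [[/= /eqP m2 _ /eqP md]|].
  exists (large m); first by rewrite inE m2.
  have fm : (f (large m) <= m)%MM.
    apply/mnm_lepP => i; rewrite mnmE.
    by case: (boolP (i \in large m)); rewrite inE; lia.
  rewrite -[LHS](submK fm).
  have /eqP : mdeg (m - f (large m)) = 0 by rewrite mdegB_le // md f_deg m2; lia.
  by rewrite mdeg_eq0 => /eqP ->; rewrite add0m.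
move=> [A]; rewrite inE => /eqP A2 ->; rewrite /= f_large A2 f_deg A2 mul2n eqxx.
split=> //; apply/boundedP => i; rewrite mnmE; case: (i \in A); lia.
Qed.

Lemma count_large0 :
  count (fun m => #|large m| == 0) square_exps =
  count (mem (bounded (fun=> d - 1))) (mnms_of_deg d.*2).
Proof.
rewrite count_filter; apply: eq_count => m /=.
apply/andP/boundedP => [[/eqP/cards0_eq m0 _] i|mb].
  by have := in_set0 i; rewrite -m0 inE; lia.
split; last by apply/boundedP => i; have := mb i; lia.
by rewrite cards_eq0; apply/eqP/setP => i; rewrite !inE; have := mb i; lia.
Qed.

(** With [c] the number of coordinates that are at least [d], every vector of
    [square_exps] satisfies [1 + (c == 2) = c + (c == 0)], because [c <= 2]; the
    formula is the sum of these equalities. *)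
Lemma size_square_exps :
  size square_exps + 'C(n, 2) =
  n * count (mem (bounded (fun=> d - 1))) (mnms_of_deg d) +
  count (mem (bounded (fun=> d - 1))) (mnms_of_deg d.*2).
Proof.
have sum_large : \sum_(m <- square_exps) #|large m| =
    n * count (mem (bounded (fun=> d - 1))) (mnms_of_deg d).
  under eq_bigr do rewrite -sum1_card big_mkcond.
  rewrite exchange_big /=.
  transitivity
    (\sum_(i < n) count (mem (bounded (fun=> d - 1))) (mnms_of_deg d)); last first.
    by rewrite sum_nat_const card_ord.
  apply: eq_bigr => i _; rewrite -(count_square_exps_coord i) -sum1_count [RHS]big_mkcond.
  by apply: eq_bigr => m _; rewrite inE.
rewrite -sum_large -count_large0 -count_large2 -!sum1_count -sum1_size.
rewrite [X in _ + X = _]big_mkcond [X in _ = _ + X]big_mkcond -!big_split /=.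
rewrite big_seq [RHS]big_seq; apply: eq_bigr => m.
rewrite mem_square_exps => /andP[_ /eqP/large_le].
by case: #|large m| => [|[|[|]]].
Qed.

End Exponents.

(** * Krull dimension *)

Lemma idealr_closedD (R : nzRingType) (P : {pred R}) x y :
  idealr_closed P -> x \in P -> y \in P -> x + y \in P.
Proof. by move=> [_ _ h] xP yP; rewrite -[x]mul1r; apply: h. Qed.

Lemma idealr_closedM (R : nzRingType) (P : {pred R}) a x :
  idealr_closed P -> x \in P -> a * x \in P.
Proof. by move=> [h0 _ h] xP; rewrite -[a * x]addr0; apply: h. Qed.

Lemma prime_chain_sub0 (R : comNzRingType) l (P : nat -> {pred R}) i :
  prime_chain l P -> (i <= l)%N -> {subset P 0%N <= P i}.
Proof.
move=> [_ Plt]; elim: i => [_ x //|i IHi il x /(IHi (ltnW il))].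
by have [+ _] := Plt i il; apply.
Qed.

Section QuotientChains.
Variables (R : comNzRingType) (I : idealr R).
Local Notation pi := (\pi_{ideal_quot I}).

Lemma pi_eq0 x : (pi x == 0) = (x \in I).
Proof. by rewrite -(rmorph0 pi) -Quotient.idealrBE subr0. Qed.

Lemma prime_chain_of_quot l (P : nat -> {pred {ideal_quot I}}) :
  prime_chain l P ->
  exists2 Q : nat -> {pred R}, prime_chain l Q & {subset I <= Q 0%N}.
Proof.
move=> [Pp Plt]; exists (fun i x => pi x \in P i); last first.
  move=> x; rewrite -pi_eq0 unfold_in => /eqP ->.
  by have [[]] := Pp 0%N (leq0n l).
split=> i il.
  have [[P0 P1 PD] PM] := Pp i il; split.
    split; rewrite ?unfold_in ?rmorph0 ?rmorph1 // => a x y.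
    by rewrite !unfold_in rmorphD rmorphM; apply: PD.
  by move=> x y; rewrite !unfold_in rmorphM; apply: PM.
have [Psub Pne] := Plt i il; split=> [x|eqP].
  by rewrite !unfold_in; apply: Psub.
by apply: Pne => x; have := eqP (repr x); rewrite !unfold_in reprK.
Qed.

Lemma prime_chain_quot l (Q : nat -> {pred R}) :
  prime_chain l Q -> {subset I <= Q 0%N} ->
  exists P : nat -> {pred {ideal_quot I}}, prime_chain l P.
Proof.
move=> Qchain IQ0; have [Qp Qlt] := Qchain.
pose P i : {pred {ideal_quot I}} := fun x => repr x \in Q i.
have piQ i x : (i <= l)%N -> (pi x \in P i) = (x \in Q i).
  move=> il; rewrite unfold_in.
  have [Qi _] := Qp i il.
  have sub y z : pi y = pi z -> y \in Q i -> z \in Q i.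
    move=> yz yQ; rewrite -[z](subrK y); apply: idealr_closedD => //.
    apply: prime_chain_sub0 Qchain il _ _; apply: IQ0.
    by rewrite -pi_eq0 rmorphB /= yz subrr.
  by apply/idP/idP; apply: sub; rewrite reprK.
exists P; split=> i il.
  have [[Q0 Q1 QD] QM] := Qp i il; split.
    split; rewrite -?(rmorph0 pi) -?(rmorph1 pi) ?piQ // => a x y.
    by rewrite -[a]reprK -[x]reprK -[y]reprK -rmorphM -rmorphD !piQ //; apply: QD.
  move=> x y.
  by rewrite -[x]reprK -[y]reprK -rmorphM !piQ //; apply: QM.
have [Qsub Qne] := Qlt i il; have ilW := ltnW il; split=> [x|eqP].
  by rewrite -[x]reprK !piQ //; apply: Qsub.
by apply: Qne => x; have := eqP (pi x); rewrite !piQ.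
Qed.

End QuotientChains.

Lemma msizeM_idomain (K : idomainType) n (p q : {mpoly K[n]}) :
  (msize (p * q) <= (msize p + msize q).-1)%N.
Proof.
have [->|p0] := eqVneq p 0; first by rewrite mul0r msize0.
have [->|q0] := eqVneq q 0; first by rewrite mulr0 msize0.
by rewrite msizeM.
Qed.

Section Growth.
Variables (K : fieldType) (n : nat) (A : comNzRingType).
Variables (h : {rmorphism K -> A}) (phi : {rmorphism A -> {mpoly K[n]}}).
Hypothesis phi_h : forall c, phi (h c) = c%:MP.
Implicit Types P : {pred A}.

Definition free_mod P (J : finType) (z : J -> A) : Prop :=
  forall c : J -> K, \sum_j h (c j) * z j \in P -> forall j, c j = 0.

(** Reducing a relation modulo [P1] kills every term except those with [f ^ 0];
    what is left can be divided by [f], which is a non zero divisor modulo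
    [P0]. *)
Lemma free_mod_powers P0 P1 f (J : finType) (z : J -> A) k :
  prime_ideal P0 -> idealr_closed P1 -> {subset P0 <= P1} ->
  f \in P1 -> f \notin P0 -> free_mod P1 z ->
  free_mod P0 (fun u : 'I_k * J => f ^+ u.1 * z u.2).
Proof.
move=> [P0i P0p] P1i P01 fP1 fP0 zP1 c cP0 [r j].
suff powers (c' : 'I_k -> J -> K) :
    \sum_(r < k) f ^+ r * (\sum_j h (c' r j) * z j) \in P0 ->
    forall r j, c' r j = 0.
  apply: (powers (fun r j => c (r, j))); move: cP0.
  congr (_ \in P0); under [RHS]eq_bigr do rewrite mulr_sumr.
  rewrite pair_bigA; apply: eq_bigr => -[r' j'] _ /=; exact: mulrCA.
elim: k c' {c cP0 r j} => [|k IHk] c; first by move=> _ [].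
rewrite big_ord_recl expr0 mul1r => cP0.
have {cP0}: \sum_j h (c ord0 j) * z j +
    f * (\sum_(r < k) f ^+ r * \sum_j h (c (lift ord0 r) j) * z j) \in P0.
  move: cP0; congr (_ + _ \in P0); rewrite mulr_sumr.
  by apply: eq_bigr => r _; rewrite mulrA -exprS.
set rest := (X in f * X) => cP0.
have c0 j : c ord0 j = 0.
  apply: zP1; rewrite -[X in X \in _](addrK (f * rest)) -mulrN [f * - _]mulrC.
  apply: idealr_closedD => //; first exact: P01.
  exact: idealr_closedM.
have restP0 : rest \in P0.
  have : f * rest \in P0.
    by move: cP0; rewrite big1 ?add0r // => j _; rewrite c0 rmorph0 mul0r.
  by move=> /(P0p f rest); rewrite (negPf fP0).
move=> r j; case: (unliftP ord0 r) => [r' ->|->]; last exact: c0.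
apply: (IHk (fun r => c (lift ord0 r)) restP0 r' j).
Qed.

(** One step of the chain multiplies the size of the family by [k], and the
    degrees grow by at most [k] times the degree of one fixed element of the
    larger prime. *)
Lemma prime_chain_growth l (P : nat -> {pred A}) :
  prime_chain l P ->
  exists D, forall k, exists (J : finType) (z : J -> A),
    [/\ #|J| = (k ^ l)%N, free_mod (P 0%N) z
      & forall j, (msize (phi (z j)) <= (k * D).+1)%N].
Proof.
elim: l P => [|l IHl] P [Pp Plt].
  exists 0%N => k; exists unit, (fun=> 1); split=> [|c|_]; last 1 first.
  - by rewrite rmorph1 msize1.
  - by rewrite card_unit.
  have [P0i _] := Pp 0%N (leqnn 0); have [_ P1 _] := P0i.
  rewrite (bigD1 tt) //= big1 => [|[]//]; rewrite addr0 mulr1 => cP [].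
  apply/eqP; apply: contraNT P1 => c0.
  by rewrite -(rmorph1 h) -(mulVf c0) rmorphM; apply: idealr_closedM.
have [D0 IH] := IHl (fun i => P i.+1)
  (conj (fun i => Pp i.+1) (fun i => Plt i.+1)).
have [P01 neP01] := Plt 0%N (ltn0Sn l).
have [f [fP1 fP0]] : exists f, f \in P 1%N /\ f \notin P 0%N.
  apply: contra_notP neP01 => nof x; apply/idP/idP; first exact: P01.
  by move=> xP1; apply: contra_notT nof => xP0; exists x.
exists (D0 + msize (phi f))%N => k; have [J [z [Jk zP zD]]] := IH k.
exists ('I_k * J)%type, (fun u : 'I_k * J => f ^+ u.1 * z u.2); split.
- by rewrite card_prod card_ord Jk expnS.
- by apply: (free_mod_powers (Pp 0%N _) (Pp 1%N _).1 P01).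
move=> [r j] /=; rewrite rmorphM rmorphXn /=.
have szX : (msize (phi f ^+ r) <= (r * msize (phi f)).+1)%N.
  elim: (r : nat) => [|i IHi]; first by rewrite expr0 msize1.
  rewrite exprS; apply: leq_trans (msizeM_idomain _ _) _.
  rewrite -subn1 leq_subLR add1n; apply: leq_trans (leq_add (leqnn _) IHi) _.
  by rewrite mulSn addnS.
apply: leq_trans (msizeM_idomain _ _) _.
rewrite -subn1 leq_subLR add1n; apply: leq_trans (leq_add szX (zD j)) _.
rewrite addSn addnS mulnDr addnC !ltnS leq_add2l leq_mul2r.
by rewrite ltnW ?orbT // ltn_ord.
Qed.

(** The exponents of monomials of degree at most [N] lie in a box with
    [N.+1 ^ n] points. *)
Lemma card_independent_mpoly (J : finType) (w : J -> {mpoly K[n]}) N :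
  (forall j, (msize (w j) <= N.+1)%N) ->
  (forall c : J -> K, \sum_j c j *: w j = 0 -> forall j, c j = 0) ->
  (#|J| <= N.+1 ^ n)%N.
Proof.
move=> wN wfree.
pose E := {ffun 'I_n -> 'I_N.+1}.
pose M := \matrix_(i < #|J|, k < #|E|)
  (w (enum_val i))@_[multinom (enum_val k : E) a : nat | a < n].
suff Mfree : row_free M.
  have -> : (N.+1 ^ n = #|E|)%N by rewrite card_ffun !card_ord.
  by rewrite -(eqP Mfree) rank_leq_col.
apply: inj_row_free => v vM.
have /wfree c0 : \sum_j v 0 (enum_rank j) *: w j = 0.
  apply/mpolyP => m; rewrite mcoeff0 raddf_sum /=.
  have [mN|mN] := ltnP N (mdeg m).
    apply: big1 => j _; rewrite mcoeffZ memN_msupp_eq0 ?mulr0 //.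
    by apply: msize_mdeg_ge; apply: leq_trans mN.
  have mi a : (m a < N.+1)%N.
    by rewrite ltnS (leq_trans _ mN) // mdegE (bigD1 a) //= leq_addr.
  pose k : E := [ffun a => Ordinal (mi a)].
  transitivity ((v *m M) 0 (enum_rank k)); last by rewrite vM mxE.
  rewrite mxE (reindex (@enum_val J J)) /=; last first.
    by exists enum_rank => x _; rewrite (enum_valK, enum_rankK).
  apply: eq_bigr => i _; rewrite mcoeffZ !mxE enum_valK; congr (_ * mcoeff _ _).
  by apply/mnmP => a; rewrite mnmE enum_rankK ffunE.
by apply/rowP => i; rewrite mxE -[i]enum_valK c0.
Qed.

(** Independence modulo [P 0], which contains the kernel of [phi], gives linear
    independence in the polynomial ring, so [k ^ l <= (k * D).+1 ^ n] for all
    [k]; if [n < l] this fails for large [k]. *)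
Lemma prime_chain_le l (P : nat -> {pred A}) :
  prime_chain l P -> (forall x, phi x = 0 -> x \in P 0%N) -> (l <= n)%N.
Proof.
move=> /prime_chain_growth[D growth] kerP; rewrite leqNgt; apply/negP => nl.
(* With this [k], [(k * D.+1) ^ n < k ^ n.+1]. *)
have [J [z [Jk zP zD]]] := growth (D.+1 ^ n).+1.
set k := (D.+1 ^ n).+1 in Jk zD.
have : (#|J| <= (k * D).+1 ^ n)%N.
  apply: card_independent_mpoly zD _ => c cz; apply: zP; apply: kerP.
  rewrite -[RHS]cz raddf_sum; apply: eq_bigr => j _ /=.
  by rewrite rmorphM phi_h mul_mpolyC.
apply/negP; rewrite Jk -ltnNge.
apply: (@leq_ltn_trans ((k * D.+1) ^ n)).
  by case: (n) => // n'; rewrite leq_exp2r // mulnS -add1n leq_add2r.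
rewrite (leq_trans _ (leq_pexp2l _ nl)) // expnMn expnSr ltn_pmul2l ?expn_gt0 //.
Qed.

End Growth.

(** * The fiber cone of an equigenerated monomial ideal *)

Section ReesConst.
Variables (K : fieldType) (n : nat) (I : {pred {mpoly K[n]}}).

Lemma rees_const_subproof (c : K) :
  (c%:MP%:P : {poly {mpoly K[n]}}) \in rees_pred I.
Proof.
apply/asboolP => k; rewrite coefC; case: k => [|k] //=.
by have [] := ideal_exp_closed I k.+1.
Qed.

Definition rees_const (c : K) : rees I := Rees (rees_const_subproof c).

Lemma rees_const_is_additive : zmod_morphism rees_const.
Proof. by move=> a b; apply: val_inj; rewrite /= !rmorphB. Qed.

Lemma rees_const_is_multiplicative : monoid_morphism rees_const.
Proof.
by split=> [|a b]; apply: val_inj; rewrite /= ?rmorph1 ?rmorphM.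
Qed.

HB.instance Definition _ :=
  GRing.isZmodMorphism.Build K (rees I) rees_const rees_const_is_additive.
HB.instance Definition _ :=
  GRing.isMonoidMorphism.Build K (rees I) rees_const rees_const_is_multiplicative.

End ReesConst.

Section FiberMap.
Variables (K : fieldType) (n : nat).
Local Notation S := {mpoly K[n]}.
Variables (I : {pred S}) (B : {pred 'X_{1..n}}) (e : nat).
Hypotheses (e_gt0 : (0 < e)%N) (IB : I =i monomial_ideal B).
Hypothesis (Be : {in B, forall m, mdeg m = e}).

Lemma ideal_exp_mdeg k (q : S) :
  q \in ideal_exp I k -> {in msupp q, forall m, (e * k <= mdeg m)%N}.
Proof.
rewrite (ideal_exp_monomial k IB) => /monomial_idealP qk m /qk[b bk /lem_mdeg].
by rewrite (mdeg_mnm_sums Be bk).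
Qed.

Lemma rees_coef (p : rees I) k : (rees_val p)`_k \in ideal_exp I k.
Proof. by case: p => p /= /asboolP. Qed.

Lemma irrelevant_ideal_monomial :
  @irrelevant_ideal K n =i monomial_ideal [pred m | mdeg m == 1%N].
Proof.
move=> p; apply/idP/idP; apply: ideal_gen_sub => q.
  move=> /existsP[i /eqP ->]; apply: mem_monomial_ideal (lepm_refl _).
  by rewrite inE mdeg1.
move=> /asboolP[m /mdeg1P[i /eqP ->] ->]; apply: mem_ideal_gen.
by apply/existsP; exists i.
Qed.

(** A term of degree above [e * k] that is divisible by a generator of [I ^ k]
    has a variable to spare, so it lies in [m I ^ k]. *)
Lemma mem_irrelevant_ideal_exp k (q : S) : q \in ideal_exp I k ->
  (q \in ideal_prod (@irrelevant_ideal K n) (ideal_exp I k)) =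
  (pihomog mdeg (e * k) q == 0).
Proof.
move=> qIk.
rewrite (ideal_prod_monomial irrelevant_ideal_monomial (ideal_exp_monomial k IB)).
apply/monomial_idealP/eqP => [qmIk|q0 m mq].
  apply/mpolyP => m; rewrite mcoeff_pihomog mcoeff0; case: eqP => // me.
  apply: memN_msupp_eq0; apply/negP => /qmIk[b /asboolP[a [c [/eqP a1 ck ->]]]].
  by move=> /lem_mdeg; rewrite mdegD a1 (mdeg_mnm_sums Be ck) me add1n ltnn.
move: qIk; rewrite (ideal_exp_monomial k IB) => /monomial_idealP /(_ m mq)[b bk].
move=> /mnm_lepP bm; have [i bi] : exists i, (b i < m i)%N.
  apply: contraTP (mq) => bm'; have bE : b = m.
    apply/mnmP => i; apply/eqP; rewrite eqn_leq bm leqNgt.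
    by apply/negP => bi; apply: bm'; exists i.
  have := congr1 (mcoeff m) q0; rewrite mcoeff_pihomog mcoeff0.
  by rewrite -{1}bE (mdeg_mnm_sums Be bk) eqxx => /eqP; rewrite mcoeff_eq0.
exists (U_(i) + b)%MM.
  by apply/asboolP; exists U_(i)%MM, b; split; rewrite ?inE ?mdeg1.
apply/mnm_lepP => j; rewrite mnmDE mnm1E.
by case: eqP => [<-|_]; rewrite ?add1n ?add0n.
Qed.

(** Since the [k]-th coefficient of [p] has no term of degree below [e * k],
    keeping its part of this degree is multiplicative. *)
Definition initial_form (p : rees I) : {poly S} :=
  \poly_(k < size (rees_val p)) pihomog mdeg (e * k) (rees_val p)`_k.

Lemma coef_initial_form p k :
  (initial_form p)`_k = pihomog mdeg (e * k) (rees_val p)`_k.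
Proof.
by rewrite coef_poly; case: ltnP => // kp; rewrite nth_default // raddf0.
Qed.

Lemma initial_formB p q : initial_form (p - q) = initial_form p - initial_form q.
Proof.
by apply/polyP => k; rewrite coefB !coef_initial_form coefB raddfB.
Qed.

Lemma initial_form1 : initial_form 1 = 1.
Proof.
apply/polyP => k; rewrite coef_initial_form !coef1.
case: k => [|k]; last by rewrite raddf0.
by rewrite muln0 -mpolyX0 pihomogX /= mdeg0.
Qed.

Lemma initial_formM p q : initial_form (p * q) = initial_form p * initial_form q.
Proof.
apply/polyP => k; rewrite coef_initial_form !coefM raddf_sum /=.
apply: eq_bigr => i _; rewrite !coef_initial_form -pihomogM_low.
- by rewrite -mulnDr subnKC // -ltnS.
- exact: ideal_exp_mdeg (rees_coef p i).
- exact: ideal_exp_mdeg (rees_coef q _).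
Qed.

Lemma initial_form_eq0 p : (initial_form p == 0) = (p \in @fiber_ideal K n I).
Proof.
apply/eqP/asboolP => [p0 k|pI].
  by rewrite mem_irrelevant_ideal_exp ?rees_coef // -coef_initial_form p0 coef0.
apply/polyP => k; rewrite coef0 coef_initial_form; apply/eqP.
by rewrite -mem_irrelevant_ideal_exp // rees_coef.
Qed.

Lemma initial_form_at1 p : ((initial_form p).[1] == 0) = (initial_form p == 0).
Proof.
apply/eqP/eqP => [p0|->]; last by rewrite horner0.
apply/polyP => k; rewrite coef0.
have [kp|] := ltnP k (size (initial_form p)); last exact: nth_default.
have := congr1 (pihomog mdeg (e * k)) p0; rewrite raddf0 horner_coef raddf_sum /=.
rewrite (bigD1 (Ordinal kp)) //= big1 => [|i ik].
  by rewrite expr1n mulr1 addr0 !coef_initial_form pihomog_id.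
rewrite expr1n mulr1 coef_initial_form (pihomog_ne0 _ (pihomogP _ _ _)) //.
by rewrite eqn_pmul2l.
Qed.

(** Setting the grading variable to 1 loses nothing, because the initial forms
    of different components have different degrees; this embeds the fiber cone
    in the polynomial ring. *)
Lemma fiber_map_exists :
  exists phi : {rmorphism rees I -> S},
    [/\ forall p, (phi p == 0) = (p \in @fiber_ideal K n I),
        forall c, phi (rees_const I c) = c%:MP
      & forall k u, u \in mnm_sums B k -> exists p, phi p = 'X_[u]].
Proof.
pose f p := (initial_form p).[1].
have fB : zmod_morphism f by move=> p q; rewrite /f initial_formB hornerD hornerN.
have fM : monoid_morphism f.
  by split=> [|p q]; rewrite /f ?initial_form1 ?initial_formM ?hornerM ?hornerC.
pose fBm := GRing.isZmodMorphism.Build _ _ f fB.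
pose fMm := GRing.isMonoidMorphism.Build _ _ f fM.
pose phi : {rmorphism rees I -> S} := HB.pack f fBm fMm.
exists phi; split=> [p|c|k u uk].
- by rewrite -initial_form_eq0 -initial_form_at1.
- rewrite /= /f (_ : initial_form _ = c%:MP%:P) ?hornerC //.
  apply/polyP => k; rewrite coef_initial_form !coefC.
  case: k => [|k]; last by rewrite raddf0.
  by rewrite muln0 -[c%:MP]mulr1 mul_mpolyC linearZ -mpolyX0 /= pihomogX /= mdeg0.
have uP : 'X_[u] *: 'X^k \in rees_pred I.
  apply/asboolP => i; rewrite coefZ coefXn; case: eqP => [->|_].
    rewrite mulr1 (ideal_exp_monomial k IB).
    exact: mem_monomial_ideal uk (lepm_refl _).
  by rewrite mulr0; have [] := ideal_exp_closed I i.
exists (Rees uP); rewrite /= /f (_ : initial_form _ = 'X_[u] *: 'X^k).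
  by rewrite hornerZ hornerXn expr1n mulr1.
apply/polyP => i; rewrite coef_initial_form !coefZ !coefXn.
case: eqP => [->|_]; last by rewrite mulr0 raddf0.
by rewrite mulr1 pihomogX /= (mdeg_mnm_sums Be uk) eqxx.
Qed.

(** This is the bound on the dimension, the growth argument being applied in the
    Rees algebra to the preimages of the primes of the fiber cone. *)
Lemma fiber_cone_prime_chain_le l (P : nat -> {pred fiber_cone I}) :
  prime_chain l P -> (l <= n)%N.
Proof.
have [phi [ker phiC _]] := fiber_map_exists.
move=> /prime_chain_of_quot[Q Qchain IQ].
apply: (prime_chain_le phiC Qchain) => x /eqP.
by rewrite ker; apply: IQ.
Qed.

End FiberMap.

(** * Analytic spread from exponents in echelon form *)

Section Specialization.
Variables (K : fieldType) (n : nat).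
Local Notation S := {mpoly K[n]}.

Definition specialize (j : nat) (q : S) : S :=
  q \mPo [tuple if (i < j)%N then 1 else 'X_i | i < n].

HB.instance Definition _ j := GRing.RMorphism.copy (specialize j)
  (comp_mpoly [tuple if (i < j)%N then 1 else 'X_i | i < n]).

Definition mnm_drop (j : nat) (m : 'X_{1..n}) : 'X_{1..n} :=
  [multinom if (i < j)%N then 0%N else m i | i < n].

Lemma specializeX j m : specialize j 'X_[m] = 'X_[mnm_drop j m].
Proof.
rewrite /specialize comp_mpolyX [RHS]mpolyXE_id; apply: eq_bigr => i _.
by rewrite tnth_mktuple mnmE; case: ifP; rewrite ?expr1n ?expr0.
Qed.

Lemma specializeE j q :
  specialize j q = \sum_(m <- msupp q) q@_m *: 'X_[mnm_drop j m].
Proof.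
rewrite [in LHS](mpolyE q) rmorph_sum; apply: eq_bigr => m _ /=.
by rewrite -!mul_mpolyC rmorphM /= specializeX /specialize comp_mpolyC.
Qed.

Lemma specialize_ge i j q :
  (i <= j)%N -> specialize j (specialize i q) = specialize j q.
Proof.
move=> ij; rewrite (specializeE i) rmorph_sum specializeE; apply: eq_bigr => m _ /=.
rewrite -!mul_mpolyC rmorphM /= specializeX {1}/specialize comp_mpolyC.
congr (_ * 'X_[_]); apply/mnmP => a; rewrite !mnmE.
by case: ltnP => // ja; rewrite ltnNge (leq_trans ij).
Qed.

End Specialization.

Section Echelon.
Variables (K : fieldType) (n : nat).
Local Notation S := {mpoly K[n]}.
Variables (I : {pred S}) (B : {pred 'X_{1..n}}) (e : nat).
Hypotheses (e_gt0 : (0 < e)%N) (IB : I =i monomial_ideal B).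
Hypothesis (Be : {in B, forall m, mdeg m = e}).

(** The kernels of the specializations of the first [j] variables, for
    [0 <= j <= n], are [n + 1] primes of the fiber cone.  The hypothesis says that
    the monomials with exponents [u] and [v] get identified when the [j]-th
    variable is specialized, and not before. *)
Lemma analytic_spread_echelon :
  (forall j : 'I_n, exists k l u v,
     [/\ u \in mnm_sums B k, v \in mnm_sums B l, u j != v j
       & forall i : 'I_n, (j < i)%N -> u i = v i]) ->
  has_analytic_spread I n.
Proof.
move=> echelon; split; last first.
  by move=> k P; apply: (fiber_cone_prime_chain_le e_gt0 IB Be).
have [phi [ker _ phiX]] := fiber_map_exists e_gt0 IB Be.
pose Q j : {pred rees I} := fun p => specialize j (phi p) == 0.
have QE j p : (p \in Q j) = (specialize j (phi p) == 0) by [].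
apply: (@prime_chain_quot _ _ n Q); last first.
  by move=> p; rewrite -ker QE => /eqP ->; rewrite rmorph0.
split=> [j jn|j jn].
  split.
    split; rewrite ?QE ?rmorph0 ?rmorph1 ?oner_eq0 // => a x y.
    rewrite !QE rmorphD rmorphM /= rmorphD rmorphM /= => /eqP -> /eqP ->.
    by rewrite mulr0 addr0.
  by move=> x y; rewrite !QE rmorphM /= rmorphM /= mulf_eq0.
split=> [p|eqQ].
  by rewrite !QE -(specialize_ge _ (leqnSn j)) => /eqP ->; rewrite rmorph0.
have [k [l [u [v [uk vl uv uvE]]]]] := echelon (Ordinal jn).
have [[p pX] [q qX]] := (phiX k u uk, phiX l v vl).
have /esym := eqQ (p - q).
rewrite !QE !rmorphB /= pX qX !specializeX.
have -> : mnm_drop j.+1 u = mnm_drop j.+1 v.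
  by apply/mnmP => i; rewrite !mnmE; case: ltnP => // /uvE.
rewrite subrr eqxx subr_eq0 => /esym/eqP uvX.
have := congr1 (mcoeff (mnm_drop j u)) uvX; rewrite !mcoeffX eqxx.
case: eqP => [dropE _|_ /eqP]; last by rewrite oner_eq0.
case/eqP: uv; have := congr1 (fun m : 'X_{1..n} => m (Ordinal jn)) dropE.
by rewrite !mnmE /= ltnn.
Qed.

End Echelon.

(** * Ideals of Veronese type *)

Lemma has_krull_dim_inj (R : comNzRingType) l1 l2 :
  has_krull_dim R l1 -> has_krull_dim R l2 -> l1 = l2.
Proof.
move=> [[P1 c1] m1] [[P2 c2] m2]; apply/eqP.
by rewrite eqn_leq (m2 _ _ c1) (m1 _ _ c2).
Qed.

Section Veronese.
Variables (n d : nat).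
Hypothesis d_gt1 : (1 < d)%N.

Definition veronese_exps : {pred 'X_{1..n}} :=
  [pred b : 'X_{1..n} | (mdeg b == d) && [forall i, (b i <= d - 1)%N]].

Lemma veronese_exps_deg : {in veronese_exps, forall m, mdeg m = d}.
Proof. by move=> m /andP[/eqP]. Qed.

Lemma mem_veronese_exps m :
  (m \in [seq m <- mnms_of_deg n d | m \in bounded (fun=> d - 1)%N]) =
  (m \in veronese_exps).
Proof. by rewrite mem_filter mem_mnms_of_deg andbC. Qed.

Lemma mnm_sums1 (B : {pred 'X_{1..n}}) b : b \in B -> b \in mnm_sums B 1.
Proof.
by move=> bB; apply/asboolP; exists b, 0%MM; rewrite addm0; split; rewrite ?inE.
Qed.

Lemma mnm_sums2 (B : {pred 'X_{1..n}}) b c :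
  b \in B -> c \in B -> (b + c)%MM \in mnm_sums B 2.
Proof. by move=> bB cB; apply/asboolP; exists b, c; rewrite mnm_sums1. Qed.

Lemma mem_veronese_square_exps m :
  (m \in square_exps n d) = (m \in mnm_sums veronese_exps 2).
Proof.
rewrite mem_square_exps; apply/idP/asboolP.
  move=> /andP[/(@bounded_split n (fun=> d - 1)%N d) split_m /eqP /split_m].
  move=> [b [c [bd cd bb cb ->]]]; exists b, c; split=> //.
    by rewrite inE bd eqxx.
  by apply: mnm_sums1; rewrite inE cd eqxx.
move=> [b [_ [/andP[/eqP bd /forallP bb] /asboolP[c [_ [+ /eqP-> ->]]] ->]]].
move=> /andP[/eqP cd /forallP cb]; rewrite addm0 mdegD bd cd addnn eqxx andbT.
by apply/boundedP => i; rewrite mnmDE; have := bb i; have := cb i; lia.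
Qed.

(** The witnesses are products of [x_0 ^ (d - 1) x_k], [x_0 ^ (d - 1) x_j] and
    [x_0 ^ (d - 2) x_j x_k]: replacing [x_j] by [x_0] in the last one gives the
    first one, which settles [j] different from 0, and the product of the first
    two differs from the last one by a power of [x_0], which settles [j = 0]. *)
Lemma veronese_echelon (j : 'I_n) : (1 < n)%N -> (d < n * (d - 1))%N ->
  exists k l u v, [/\ u \in mnm_sums veronese_exps k,
    v \in mnm_sums veronese_exps l, u j != v j
    & forall i : 'I_n, (j < i)%N -> u i = v i].
Proof.
move=> n_gt1 dn; pose o : 'I_n := Ordinal (ltnW n_gt1).
have exchange (i : 'I_n) : i != o -> exists2 k, k != o & (d == 2) ==> (k != i).
  move=> io; have [d2|d2] := eqVneq d 2; last by exists i.
  have n_gt2 : (2 < n)%N by move: dn; rewrite d2; lia.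
  pose o1 : 'I_n := Ordinal n_gt1; pose o2 : 'I_n := Ordinal n_gt2.
  by have [->|i1] := eqVneq i o1; [exists o2 | exists o1; rewrite // eq_sym].
have veroP b : mdeg b = d -> (forall i, (b i <= d - 1)%N) -> b \in veronese_exps.
  by move=> bd bb; rewrite inE bd eqxx; apply/forallP.
have corner (k : 'I_n) : k != o -> (U_(o) *+ (d - 1) + U_(k))%MM \in veronese_exps.
  move=> ko; apply: veroP => [|i]; first by rewrite mdegD mdegMn !mdeg1; lia.
  rewrite mnmDE mnmMnUE mnm1E; move: ko.
  by case: (eqVneq o i) => [<- /negPf->|_ _]; lia.
have middle (i k : 'I_n) : i != o -> k != o -> (d == 2) ==> (k != i) ->
    (U_(o) *+ (d - 2) + U_(k) + U_(i))%MM \in veronese_exps.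
  move=> io ko ki; apply: veroP => [|a].
    by rewrite !mdegD mdegMn !mdeg1; lia.
  rewrite !mnmDE mnmMnUE !mnm1E; move: io ko ki.
  case: (eqVneq o a) => [<-|_]; first by move=> /negPf-> /negPf->; lia.
  by case: (eqVneq k a) => [->|_]; case: (eqVneq i a) => [->|_];
    rewrite ?eqxx //=; lia.
have [jo|jo] := eqVneq j o.
  pose i : 'I_n := Ordinal n_gt1.
  have io : i != o by [].
  have [k ko ki] := exchange i io.
  exists 2, 1, (U_(o) *+ (d - 1) + U_(k) + (U_(o) *+ (d - 1) + U_(i)))%MM.
  exists (U_(o) *+ (d - 2) + U_(k) + U_(i))%MM; split.
  - by apply: mnm_sums2; apply: corner.
  - by apply: mnm_sums1; apply: middle.
  - rewrite jo !mnmDE !mnmMnUE !mnm1E eqxx (negPf io) (negPf ko); lia.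
  move=> a; rewrite jo => oa; rewrite !mnmDE !mnmMnUE !mnm1E.
  by have /negPf -> : o != a by rewrite -val_eqE /= ltn_eqF.
have [k ko ki] := exchange j jo.
exists 1, 1, (U_(o) *+ (d - 1) + U_(k))%MM, (U_(o) *+ (d - 2) + U_(k) + U_(j))%MM.
split.
- by apply/mnm_sums1/corner.
- by apply/mnm_sums1/middle.
- by rewrite !mnmDE !mnmMnUE !mnm1E eqxx (eq_sym o) (negPf jo); lia.
move=> a ja; rewrite !mnmDE !mnmMnUE !mnm1E.
have /negPf -> : j != a by rewrite -val_eqE /= ltn_eqF.
have /negPf -> : o != a by rewrite -val_eqE /= ltn_eqF // (leq_ltn_trans _ ja).
by lia.
Qed.

Section Invariants.
Variable K : fieldType.
Local Notation V := (veronese_type K n (fun=> d - 1)%N d).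
Local Notation mu1 := (count (mem (bounded (fun=> d - 1)%N)) (mnms_of_deg n d)).

Lemma veronese_min_gens : has_min_gens V mu1.
Proof.
rewrite -size_filter; apply: (@min_gens_monomial_ideal _ _ _ _ d).
- exact: filter_uniq (mnms_of_deg_uniq _ _).
- by move=> m; rewrite mem_veronese_exps; apply: veronese_exps_deg.
by apply: eq_monomial_ideal => m; rewrite mem_veronese_exps.
Qed.

Lemma veronese_square_min_gens :
  has_min_gens (ideal_exp V 2) (size (square_exps n d)).
Proof.
apply: (@min_gens_monomial_ideal _ _ _ _ d.*2).
- exact: square_exps_uniq.
- by move=> m; rewrite mem_square_exps => /andP[_ /eqP].
move=> p; rewrite (@ideal_exp_monomial _ _ _ veronese_exps) //.
by apply: eq_monomial_ideal => m; rewrite mem_veronese_square_exps.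
Qed.

Lemma veronese_analytic_spread :
  (1 < n)%N -> (d < n * (d - 1))%N -> has_analytic_spread V n.
Proof.
move=> n_gt1 dn; apply: (@analytic_spread_echelon _ _ _ veronese_exps d) => //.
- exact: ltnW.
- exact: veronese_exps_deg.
by move=> j; apply: veronese_echelon.
Qed.

(** The defect in the Freiman equation is read off from [size_square_exps]. *)
Lemma veronese_freimanE : (1 < n)%N -> (d < n * (d - 1))%N ->
  freiman V <->
  count (mem (bounded (fun=> d - 1)%N)) (mnms_of_deg n d.*2) = 0%N.
Proof.
move=> n_gt1 dn; have counted := size_square_exps n d_gt1.
split=> [[_ [m1 [m2 [l [V1 V2 Vl muE]]]]]|none].
  move: muE; rewrite (has_min_gens_inj V1 veronese_min_gens).
  rewrite (has_min_gens_inj V2 veronese_square_min_gens).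
  rewrite (has_krull_dim_inj Vl (veronese_analytic_spread n_gt1 dn)).
  by move: counted; lia.
split; first by exists d, veronese_exps; split; [apply: veronese_exps_deg|].
exists mu1, (size (square_exps n d)), n; split.
- exact: veronese_min_gens.
- exact: veronese_square_min_gens.
- exact: veronese_analytic_spread.
by move: counted; rewrite none; lia.
Qed.

End Invariants.

Lemma bounded_deg_empty :
  (count (mem (bounded (fun=> d - 1)%N)) (mnms_of_deg n d.*2) == 0%N) =
  (n * (d - 1) < d.*2)%N.
Proof.
apply/idP/idP => [|nd].
  apply: contraTT; rewrite -leqNgt => nd.
  have /exists_bounded[m md mb] : (d.*2 <= \sum_(i < n) (d - 1))%N.
    by rewrite sum_nat_const card_ord.
  rewrite -lt0n -has_count; apply/hasP; exists m => //.
  by rewrite mem_mnms_of_deg md.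
rewrite -leqn0 leqNgt -has_count; apply/hasPn => m.
rewrite mem_mnms_of_deg => /eqP md; apply/boundedP => mb; move: nd.
apply/negP; rewrite -leqNgt -md mdegE.
rewrite -[n in (_ <= n * _)%N]card_ord -sum_nat_const.
by apply: leq_sum => i _; apply: mb.
Qed.

End Veronese.

Local Close Scope quotient_scope.
Local Close Scope ring_scope.

Theorem theorem3p6 (K : fieldType) (n d : nat)
  (hn : 2 <= n) (hd : 2 <= d) (hnd : d < n * (d - 1)) :
  freiman (veronese_type K n (fun=> d - 1) d) <->
  (n = 2 \/ (n = 3 /\ d = 2)).
Proof.
rewrite veronese_freimanE // (rwP eqP) bounded_deg_empty.
split=> [nd|]; last by lia.
have [n2|n2] := leqP n 2; first by left; lia.
have n3 : n = 3 by nia.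
by right; split=> //; move: nd; rewrite n3; lia.
Qed.
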